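(* Let $d\ge 2$, let $G$ be a liftable group acting on $T_d$, and let $\sigma\colon G\to \mathrm{St}_G(i)$ be the corresponding lifting. Then: (i) There is an embedding $\theta$ of the ascending HNN extension $$\widetilde G=G*_\sigma=\langle G,t\mid \text{relations in } G,\ tgt^{-1}=\sigma(g)\ \text{for all } g\in G\rangle$$ of $G$ by $\sigma$ into $\mathrm{Aut}(\widetilde T_{d+1})_{\omega}$ for the end $\omega=0^{-\infty}$ of $\widetilde T_{d+1}$, such that the following hold. (ii) If $G$ acts transitively on the first level of $T_d$, then $G$ is self-replicating, $\theta(\widetilde G)$ acts transitively on the set of vertices of $\widetilde T_{d+1}$, and the closure $W$ of $\theta(\widetilde G)$ in $\mathrm{Aut}(\widetilde T_{d+1})_{\omega}$ is a scale group. (iii) The projection $\pi_{\Lambda}$ maps $\mathrm{St}_{\theta(\widetilde G)}(\Lambda)$ onto $G$ and $\mathrm{St}_{\theta(\widetilde G)}(\Lambda)=\bigl(\ker\pi_{\Lambda}\cap\theta(\widetilde G)\bigr)\rtimes\theta(G)$. (iv) Let $W$ be the closure of $\theta(\widetilde G)$ in $\mathrm{Aut}(\widetilde T_{d+1})_{\omega}$ and $\overline G$ the closure of $G$ in $\mathrm{Aut}(T_d)$. The projection $\pi_{\Lambda}$ maps $\mathrm{St}_{W}(\Lambda)$ onto $\overline{G}$ and $\mathrm{St}_{W}(\Lambda)=\bigl(\ker\pi_{\Lambda}\cap W\bigr)\rtimes \theta(\overline{G})$, where $\theta(\overline G)$ denotes the image of $\overline G$ under the extension of $\theta|_G$ to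 $\overline G$ by continuity.
   Context: Let $X=\{0,\dots,d-1\}$. $T_d$ is the rooted tree with vertex set $X^*$ (finite words), root the empty word, $v$ adjacent to $vx$ ($v\in X^*$, $x\in X$); level $n$ is $X^n$. $\mathrm{Aut}(T_d)$ is its group of root- and adjacency-preserving bijections, with the topology of pointwise convergence on vertices. Products of transformations are read left to right: $gh(y)=h(g(y))$. For $g\in\mathrm{Aut}(T_d)$ and $v\in X^*$ the section $g|_v\in\mathrm{Aut}(T_d)$ is defined by $g(vw)=g(v)\,g|_v(w)$ for all $w\in X^*$. A subgroup $G<\mathrm{Aut}(T_d)$ is self-similar if $g|_v\in G$ for all $g\in G$, $v\in X^*$. $\mathrm{St}_G(v)$ is the stabilizer of $v$ in $G$, and $\pi_v\colon \mathrm{St}_{\mathrm{Aut}(T_d)}(v)\to\mathrm{Aut}(T_d)$, $g\mapsto g|_v$, is a homomorphism. A self-similar group $G$ is self-replicating if it acts transitively on $X$ and $\pi_v(\mathrm{St}_G(v))=G$ for every $v\in X^*$. A self-similar group $G$ acting on $T_d$ is liftable if there exist $i\in X$ and a homomorphism $\sigma\colon G\to\mathrm{St}_G(i)$, called the lifting, such that $\pi_i\circ\sigma$ is the identity on $G$. $\widetilde T_{d+1}$ is the $(d+1)$-regular tree realized as $\bigcup_{n\ge0}T_d^{(n)}$, where each $T_d^{(n)}$ is a copy of $T_d$ and $T_d^{(n)}$ is embedded in $T_d^{(n+1)}$ by $v\mapsto 0v$ on vertices. The root of $T_d^{(n)}$ is denoted $0^{-n}$, and $\Lambda=0^0$ is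 the root of $T_d^{(0)}$. A vertex at level $k$ of $T_d^{(n)}$ has level $k-n$; the children of a vertex of level $l$ are its $d$ neighbours of level $l+1$. Ends are equivalence classes of infinite geodesic rays (equivalent if they eventually coincide); $\omega=0^{-\infty}$ is the end of the ray $(0^{-n})_{n\ge0}$. $\mathrm{Aut}(\widetilde T_{d+1})_\omega$ is the group of automorphisms of $\widetilde T_{d+1}$ fixing $\omega$, with the topology of pointwise convergence on vertices. The subtree hanging down from each vertex $v$ is canonically identified with $T_d$ via the labels of children, and if $g\in\mathrm{Aut}(\widetilde T_{d+1})_\omega$ maps $v$ to $w$, the induced isomorphism of the hanging subtrees gives the section $g|_v\in\mathrm{Aut}(T_d)$. On the stabilizer of $\Lambda$, $\pi_\Lambda(g)=g|_\Lambda\in\mathrm{Aut}(T_d)$ is a homomorphism. For a subgroup $K$ of $\mathrm{Aut}(\widetilde T_{d+1})_\omega$, $\mathrm{St}_K(\Lambda)$ is the stabilizer of $\Lambda$ in $K$. A scale group is a closed vertex-transitive subgroup of $\mathrm{Aut}(\widetilde T_{d+1})$ fixing an end.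
   Formalization: In (iv), the extension of θ|_G to the closure of G by continuity need not exist, since σ may be discontinuous; the decomposition of St_W(Λ) is proved for every continuous extension, and existence of the extension is proved when σ is continuous. *)

(* Defs.v *)
From HB Require Import structures.
From mathcomp Require Import all_boot generic_quotient.
From mathcomp Require Import boolp classical_sets topology.
From mathcomp Require Import zify.

Set Implicit Arguments.
Unset Strict Implicit.
Unset Printing Implicit Defensive.

Local Open Scope classical_set_scope.
Local Open Scope group_scope.
Local Open Scope quotient_scope.

Definition is_subgroup (A : groupType) (S : set A) : Prop :=
  [/\ S 1, forall x y, S x -> S y -> S (x * y) & forall x, S x -> S x^-1].

Record subgroup (A : groupType) := Subgroup {
  subgroup_set :> set A;
  subgroup_setP : is_subgroup subgroup_set }.

(** Composed with the coercion from sets to types, this makes every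
    [S : subgroup A] a group; if [A] is moreover a topological space, then [S]
    carries the subspace topology of [set_type]. *)
Section SubgroupType.
Variables (A : groupType) (S : subgroup A).

Definition sg_one : S :=
  SigSub (mem_set (let: And3 S1 _ _ := subgroup_setP S in S1)).
Definition sg_mul (x y : S) : S :=
  SigSub (mem_set (let: And3 _ SM _ := subgroup_setP S in
                   SM _ _ (set_mem (valP x)) (set_mem (valP y)))).
Definition sg_inv (x : S) : S :=
  SigSub (mem_set (let: And3 _ _ SV := subgroup_setP S in
                   SV _ (set_mem (valP x)))).

Fact sg_mulA : associative sg_mul.
Proof. by move=> x y z; apply: val_inj; exact: mulgA. Qed.
Fact sg_mul1 : left_id sg_one sg_mul.
Proof. by move=> x; apply: val_inj; exact: mul1g. Qed.
Fact sg_1mul : right_id sg_one sg_mul.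
Proof. by move=> x; apply: val_inj; exact: mulg1. Qed.
Fact sg_mulV : left_inverse sg_one sg_inv sg_mul.
Proof. by move=> x; apply: val_inj; exact: mulVg. Qed.
Fact sg_Vmul : right_inverse sg_one sg_inv sg_mul.
Proof. by move=> x; apply: val_inj; exact: mulgV. Qed.

HB.instance Definition _ := isGroup.Build (set_type S)
  sg_mulA sg_mul1 sg_1mul sg_mulV sg_Vmul.
End SubgroupType.

(** [S] is the internal semidirect product of its normal subgroup [N] and its
    subgroup [H]. *)
Definition semidirect (A : groupType) (S N H : set A) : Prop :=
  [/\ [/\ is_subgroup S, is_subgroup N & is_subgroup H],
      N `<=` S /\ H `<=` S,
      forall s n, S s -> N n -> N (n ^ s),
      N `&` H = [set 1]
    & S = [set n * h | n in N & h in H]].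

(** A graph together with a set of distinguished vertices, which automorphisms
    have to fix: the root for a rooted tree, none for an unrooted one. *)
Record graph := Graph {
  vertex :> choiceType;
  adj : vertex -> vertex -> Prop;
  base : set vertex }.
Arguments base : clear implicits.

Definition is_aut (Gr : graph) (f : Gr -> Gr) : Prop :=
  [/\ bijective f,
      forall u v, adj (f u) (f v) <-> adj u v
    & forall v, base Gr v -> f v = v].

Record aut (Gr : graph) := Aut {
  aut_fun :> Gr -> Gr;
  autP : is_aut aut_fun }.

Section AutGroup.
Variable Gr : graph.
Implicit Types g h : aut Gr.

Lemma aut_ext g h : g =1 h -> g = h.
Proof.
case: g h => [f fP] [k kP] /= /funext fk; case: _ / fk kP => kP.
by congr Aut; exact: Prop_irrelevance.
Qed.

Fact id_is_aut : is_aut (@id Gr).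
Proof. by split=> //; exists id. Qed.

Fact comp_is_aut g h : is_aut (h \o g).
Proof.
case: (autP g) (autP h) => gb ga gf [hb ha hf]; split; first exact: bij_comp.
  by move=> u v; rewrite /= ha ga.
by move=> v bv; rewrite /= gf ?hf.
Qed.

Fact inv_is_aut g : exists h : aut Gr, cancel g h /\ cancel h g.
Proof.
case: (autP g) => -[h gK hK] ga gf.
suff hP : is_aut h by exists (Aut hP).
split; first by exists g.
  by move=> u v; rewrite -ga !hK.
by move=> v bv; rewrite -{1}(gf v bv) gK.
Qed.

Definition aut_one : aut Gr := Aut id_is_aut.
(** Products are read from left to right. *)
Definition aut_mul g h : aut Gr := Aut (comp_is_aut g h).
Definition aut_inv g : aut Gr := sval (cid (inv_is_aut g)).

Fact aut_mulA : associative aut_mul.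
Proof. by move=> f g h; exact: aut_ext. Qed.
Fact aut_mul1 : left_id aut_one aut_mul.
Proof. by move=> g; exact: aut_ext. Qed.
Fact aut_1mul : right_id aut_one aut_mul.
Proof. by move=> g; exact: aut_ext. Qed.
Fact aut_mulV : left_inverse aut_one aut_inv aut_mul.
Proof.
move=> g; apply: aut_ext => v /=.
by rewrite /aut_inv; case: cid => h /= [_ hK]; rewrite hK.
Qed.
Fact aut_Vmul : right_inverse aut_one aut_inv aut_mul.
Proof.
move=> g; apply: aut_ext => v /=.
by rewrite /aut_inv; case: cid => h /= [gK _]; rewrite gK.
Qed.

HB.instance Definition _ := gen_eqMixin (aut Gr).
HB.instance Definition _ := gen_choiceMixin (aut Gr).
HB.instance Definition _ := isGroup.Build (aut Gr)
  aut_mulA aut_mul1 aut_1mul aut_mulV aut_Vmul.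

(** The topology of pointwise convergence on vertices. *)
HB.instance Definition _ := Topological.copy (aut Gr)
  (initial_topology
     (fun g => g : {ptws vertex Gr -> discrete_topology (vertex Gr)})).
End AutGroup.

Definition transitive_on (Gr : graph) (K : set (aut Gr)) (V : set Gr) : Prop :=
  forall u v, V u -> V v -> exists2 g, K g & g u = v.

Definition stab (Gr : graph) (K : set (aut Gr)) (v : Gr) : set (aut Gr) :=
  [set g | K g /\ g v = v].

Notation word d := (seq 'I_d).

Definition word_adj d (u v : word d) : Prop :=
  exists x, v = rcons u x \/ u = rcons v x.

Definition tree d : graph := Graph (@word_adj d) [set [::]].

Lemma word_adjC d (u v : word d) : word_adj u v -> word_adj v u.
Proof. by case=> x [] ->; exists x; [right|left]. Qed.

Lemma cat_injl (T : eqType) (s : seq T) : injective (cat s).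
Proof. by move=> a b /eqP; rewrite eqseq_cat // eqxx => /eqP. Qed.

Lemma word_adj_cat d (v a b : word d) :
  word_adj (v ++ a) (v ++ b) <-> word_adj a b.
Proof.
split=> -[x ab]; exists x; first by case: ab; rewrite rcons_cat => /cat_injl; auto.
by rewrite !rcons_cat; case: ab => ->; auto.
Qed.

(** If [g] maps the copy [e] of [tree d] onto the copy [e'], then it induces an
    automorphism of [tree d]. *)
Lemma induced_aut (Gr : graph) d (g : aut Gr) (e e' : word d -> Gr) :
    injective e -> injective e' ->
    (forall a b, adj (e a) (e b) <-> word_adj a b) ->
    (forall a b, adj (e' a) (e' b) <-> word_adj a b) ->
    g (e [::]) = e' [::] ->
    (forall w, exists w', g (e w) = e' w') ->
    (forall w, exists w', g^-1 (e' w) = e w') ->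
  exists h : aut (tree d), forall w, g (e w) = e' (h w).
Proof.
move=> eI e'I ea e'a g0 /choice[f fE] /choice[k kE].
have gVK : cancel (g^-1 : aut Gr) g.
  by move=> v; rewrite -[RHS]/((1 : aut Gr) v) -(mulVg g).
have gKV : cancel g (g^-1 : aut Gr).
  by move=> v; rewrite -[RHS]/((1 : aut Gr) v) -(mulgV g).
suff fP : is_aut (Gr := tree d) f by exists (Aut fP).
split.
- exists k => w; [apply: eI|apply: e'I]; first by rewrite -kE -fE gKV.
  by rewrite -fE -kE gVK.
- by move=> u v; case: (autP g) => _ ga _; rewrite /= -e'a -!fE ga.
- by move=> _ ->; apply: e'I; rewrite -fE g0.
Qed.

Section Sections.
Variable d : nat.
Implicit Types (g : aut (tree d)) (v w : word d).

(** The automorphism [h] such that [g (v ++ w) = g v ++ h w] for all [w]; it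
    exists and is unique, see [sectE]. *)
Definition sect g v : aut (tree d) :=
  xget 1 [set h : aut (tree d) | forall w, g (v ++ w) = g v ++ h w].

Lemma aut_word_rcons g v x : exists y, g (rcons v x) = rcons (g v) y.
Proof.
case: (autP g) => /bij_inj gI ga gf.
elim/last_ind: v x => [|v z IHv] x.
  have: word_adj (g [::]) (g [:: x]) by apply/ga; exists x; left.
  by rewrite (gf [::] erefl) => -[y [->|/esym]]; [exists y|case: (g _)].
have: word_adj (g (rcons v z)) (g (rcons (rcons v z) x)).
  by apply/ga; exists x; left.
case=> y [->|]; first by exists y.
case: (IHv z) => y' -> /rcons_inj[/gI/(congr1 size)].
by rewrite !size_rcons => /eqP; rewrite ltn_eqF.
Qed.

Lemma aut_word_cat g v w : exists w', g (v ++ w) = g v ++ w'.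
Proof.
elim/last_ind: w => [|w x [w' gw]]; first by exists [::]; rewrite !cats0.
case: (aut_word_rcons g (v ++ w) x) => y gx.
by exists (rcons w' y); rewrite -!rcons_cat gx gw.
Qed.

Lemma sectE g v w : g (v ++ w) = g v ++ sect g v w.
Proof.
suff [h hE] : exists h : aut (tree d), forall w, g (v ++ w) = g v ++ h w.
  by rewrite /sect; case: xgetP => [h' _ -> //|/(_ h)[]].
pose e (a : word d) : tree d := v ++ a.
pose e' (a : word d) : tree d := g v ++ a.
apply: (@induced_aut (tree d) d g e e').
- by move=> a b /cat_injl.
- by move=> a b /cat_injl.
- exact: word_adj_cat.
- exact: word_adj_cat.
- by rewrite /e /e' !cats0.
- by move=> a; exact: aut_word_cat.
- move=> a; case: (aut_word_cat g^-1 (g v) a) => a' ->; exists a'.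
  by rewrite -[(g^-1 : aut _) (g v)]/((g * g^-1 : aut _) v) mulgV.
Qed.
End Sections.

Section SelfSimilar.
Variables (d : nat) (G : set (aut (tree d))).

Definition self_similar : Prop := forall g v, G g -> G (sect g v).

Definition level1_transitive : Prop :=
  transitive_on G [set [:: x] | x in [set: 'I_d]].

Definition self_replicating : Prop :=
  [/\ self_similar, level1_transitive
    & forall v : word d, [set sect g v | g in stab G v] = G].
End SelfSimilar.

(** [s] is a homomorphism from [G] to the stabilizer of the letter [i] that is
    a section of [sect^~ [:: i]]. *)
Definition is_lifting d (G : subgroup (aut (tree d))) (i : 'I_d)
    (s : {multiplicative G -> G}) : Prop :=
  forall g : G, val (s g) [:: i] = [:: i] /\ sect (val (s g)) [:: i] = val g.

Section HNN.
Variables (G : groupType) (s : {multiplicative G -> G}).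

(** Words over the generators: [inl g] stands for [g \in G], [inr true] for the
    stable letter [t] and [inr false] for its inverse. *)
Definition hnn_word : Type := seq (G + bool).

Inductive hnn_eq : hnn_word -> hnn_word -> Prop :=
| hnn_refl u : hnn_eq u u
| hnn_sym u v : hnn_eq u v -> hnn_eq v u
| hnn_trans u v w : hnn_eq u v -> hnn_eq v w -> hnn_eq u w
| hnn_cat u u' v v' : hnn_eq u u' -> hnn_eq v v' -> hnn_eq (u ++ v) (u' ++ v')
| hnn_eq1 : hnn_eq [:: inl 1] [::]
| hnn_eqM g h : hnn_eq [:: inl g; inl h] [:: inl (g * h)]
| hnn_eqtV : hnn_eq [:: inr true; inr false] [::]
| hnn_eqVt : hnn_eq [:: inr false; inr true] [::]
| hnn_eqJ g : hnn_eq [:: inr true; inl g; inr false] [:: inl (s g)].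

HB.instance Definition _ := Choice.copy hnn_word (seq (G + bool)).

Definition hnn_eqb : rel hnn_word := fun u v => `[< hnn_eq u v >].

Fact hnn_eqb_refl : reflexive hnn_eqb.
Proof. by move=> u; apply/asboolP; exact: hnn_refl. Qed.
Fact hnn_eqb_sym : symmetric hnn_eqb.
Proof. by move=> u v; apply/asboolP/asboolP; exact: hnn_sym. Qed.
Fact hnn_eqb_trans : transitive hnn_eqb.
Proof.
by move=> v u w /asboolP uv /asboolP vw; apply/asboolP; exact: hnn_trans vw.
Qed.

Canonical hnn_equiv :=
  EquivRel hnn_eqb hnn_eqb_refl hnn_eqb_sym hnn_eqb_trans.

Definition hnn : Type := {eq_quot hnn_equiv}.
HB.instance Definition _ := Choice.on hnn.

Definition hnn_class (u : hnn_word) : hnn := \pi_{eq_quot hnn_equiv} u.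

Lemma hnn_classP u v : hnn_class u = hnn_class v <-> hnn_eq u v.
Proof. by split=> [/eqmodP/asboolP|?]; last exact/eqmodP/asboolP. Qed.

Lemma hnn_classK (x : hnn) : hnn_class (repr x) = x.
Proof. exact: reprK. Qed.

Definition hnn_letterV (a : G + bool) : G + bool :=
  match a with inl g => inl g^-1 | inr b => inr (~~ b) end.
Definition hnn_wordV (u : hnn_word) : hnn_word := rev (map hnn_letterV u).

Definition hnn_one : hnn := hnn_class [::].
Definition hnn_mul (x y : hnn) : hnn := hnn_class (repr x ++ repr y).
Definition hnn_inv (x : hnn) : hnn := hnn_class (hnn_wordV (repr x)).

Lemma hnn_repr u : hnn_eq (repr (hnn_class u)) u.
Proof. by apply/hnn_classP; rewrite hnn_classK. Qed.

Lemma hnn_wordVl u : hnn_eq (hnn_wordV u ++ u) [::].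
Proof.
elim: u => [|a u IHu]; first exact: hnn_refl.
rewrite /hnn_wordV /= rev_cons cat_rcons -cat1s -(cat1s a) [_ ++ (_ ++ u)]catA.
apply: hnn_trans IHu; apply: hnn_cat (hnn_refl _) _.
rewrite -{2}[u]cat0s; apply: hnn_cat (hnn_refl _).
case: a => [g|[]] /=; [|exact: hnn_eqVt|exact: hnn_eqtV].
apply: hnn_trans (hnn_eqM _ _) _; rewrite mulVg; exact: hnn_eq1.
Qed.

Lemma hnn_wordVK : involutive hnn_wordV.
Proof.
move=> u; rewrite /hnn_wordV map_rev revK -map_comp -[RHS]map_id.
by apply: eq_map => -[g|b] /=; rewrite ?invgK ?negbK.
Qed.

Fact hnn_mulA : associative hnn_mul.
Proof.
move=> x y z; apply/hnn_classP.
apply: (@hnn_trans _ (repr x ++ (repr y ++ repr z))).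
  exact: hnn_cat (hnn_refl _) (hnn_repr _).
by rewrite catA; apply: hnn_cat (hnn_refl _); exact/hnn_sym/hnn_repr.
Qed.
Fact hnn_mul1 : left_id hnn_one hnn_mul.
Proof.
move=> x; rewrite -[RHS]hnn_classK; apply/hnn_classP.
by rewrite -{2}[repr x]cat0s; apply: hnn_cat (hnn_refl _); exact: hnn_repr.
Qed.
Fact hnn_1mul : right_id hnn_one hnn_mul.
Proof.
move=> x; rewrite -[RHS]hnn_classK; apply/hnn_classP.
by rewrite -{2}[repr x]cats0; apply: hnn_cat (hnn_refl _) _; exact: hnn_repr.
Qed.
Fact hnn_mulV : left_inverse hnn_one hnn_inv hnn_mul.
Proof.
move=> x; apply/hnn_classP; apply: hnn_trans (hnn_wordVl (repr x)).
exact: hnn_cat (hnn_repr _) (hnn_refl _).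
Qed.
Fact hnn_Vmul : right_inverse hnn_one hnn_inv hnn_mul.
Proof.
move=> x; apply/hnn_classP.
apply: hnn_trans (hnn_cat (hnn_refl _) (hnn_repr _)) _.
by rewrite -{1}[repr x]hnn_wordVK; exact: hnn_wordVl.
Qed.

HB.instance Definition _ := isGroup.Build hnn
  hnn_mulA hnn_mul1 hnn_1mul hnn_mulV hnn_Vmul.

Definition hnn_base (g : G) : hnn := hnn_class [:: inl g].
End HNN.

Section RegularTree.
Variables (d : nat) (o : 'I_d).

(** The pair [(n, w)] stands for the vertex [w] of the [n]-th copy of
    [tree d].  The embeddings [w |-> o :: w] of each copy in the next one
    identify [(n, w)] with [(n.+1, o :: w)]; the pairs satisfying [reduced]
    are the representatives with the smallest [n]. *)
Definition reduced (p : nat * word d) : bool :=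
  (p.1 == 0) || (ohead p.2 != Some o).

Fixpoint reduce (n : nat) (w : word d) : nat * word d :=
  match n, w with
  | n'.+1, x :: w' => if x == o then reduce n' w' else (n, w)
  | _, _ => (n, w)
  end.

Fact reduce_reduced n w : reduced (reduce n w).
Proof.
by elim: n w => [|n IHn] [|x w] //=; case: ifPn.
Qed.

Definition rt_vertex : Type := {p : nat * word d | reduced p}.
HB.instance Definition _ := Choice.on rt_vertex.

(** The embedding of the [n]-th copy of [tree d]. *)
Definition copy (n : nat) (w : word d) : rt_vertex :=
  exist _ (reduce n w) (reduce_reduced n w).

Lemma copyS n w : copy n.+1 (o :: w) = copy n w.
Proof. by apply: val_inj; rewrite /= eqxx. Qed.

Lemma copy_surj (p : rt_vertex) : copy (val p).1 (val p).2 = p.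
Proof.
case: p => -[n w] red; apply: val_inj => /=.
by case: n w red => [|n] [|x w] //=; case: eqP => // ->; rewrite /reduced eqxx.
Qed.

Lemma reduce_inv n w : let: (m, u) := reduce n w in
  (m <= n) /\ w = nseq (n - m) o ++ u.
Proof.
elim: n w => [|n IHn] [|x w] /=; rewrite ?subnn //.
case: eqP => [->|_]; last by rewrite subnn.
by case: (reduce n w) (IHn w) => m u [mn ->]; rewrite subSn // ltnW.
Qed.

Lemma copy_inj n : injective (copy n).
Proof.
move=> u v /(congr1 val) /= uv.
move: (reduce_inv n u) (reduce_inv n v); rewrite uv.
by case: (reduce n v) => m w [_ ->] [_ ->].
Qed.

Definition rt_adj (p q : rt_vertex) : Prop :=
  exists n u v, [/\ word_adj u v, p = copy n u & q = copy n v].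

Definition rtree : graph := Graph rt_adj set0.

Definition rt_root : rtree := copy 0 [::].

(** The vertex at position [w] in the copy of [tree d] hanging down from [p]. *)
Definition below (p : rtree) (w : word d) : rtree :=
  copy (val p).1 ((val p).2 ++ w).

Lemma below_copy n u w : below (copy n u) w = copy n (u ++ w).
Proof.
rewrite /below /=.
elim: n u => [|n IHn] [|x u] //=; case: eqP => // ->.
by rewrite copyS IHn.
Qed.

Lemma copy_shift k n w : copy (k + n) (nseq k o ++ w) = copy n w.
Proof. by elim: k => //= k IHk; rewrite addSn copyS. Qed.

Lemma common_copy (p q : rtree) :
  exists n u v, p = copy n u /\ q = copy n v.
Proof.
rewrite -(copy_surj p) -(copy_surj q); move: (val p) (val q) => [m u] [n v] /=.
exists (m + n), (nseq n o ++ u), (nseq m o ++ v).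
by rewrite copy_shift addnC copy_shift.
Qed.

Lemma rt_adj_copy n u v : rt_adj (copy n u) (copy n v) <-> word_adj u v.
Proof.
split=> [[m [u' [v' [uv pu qv]]]]|uv]; last by exists n, u, v.
move: pu qv; rewrite -(copy_shift m n) -(copy_shift n m) addnC => /copy_inj up.
rewrite -(copy_shift m n) -(copy_shift n m) addnC => /copy_inj vq.
by apply/(word_adj_cat (nseq m o)); rewrite up vq; exact/word_adj_cat.
Qed.

Lemma below_inj p : injective (below p).
Proof. by move=> a b /copy_inj/cat_injl. Qed.

Lemma below0 p : below p [::] = p.
Proof. by rewrite /below cats0; exact: copy_surj. Qed.

Lemma below_cat p a b : below p (a ++ b) = below (below p a) b.
Proof. by rewrite [below p a]/below below_copy -catA. Qed.

Lemma rt_adj_below p a b : rt_adj (below p a) (below p b) <-> word_adj a b.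
Proof. by rewrite /below rt_adj_copy; exact: word_adj_cat. Qed.

Lemma rt_adjP p q : rt_adj p q ->
  (exists x, q = below p [:: x]) \/ (exists x, p = below q [:: x]).
Proof.
by case=> n [u [v [[x [->|->]] -> ->]]]; [left|right]; exists x;
  rewrite below_copy cats1.
Qed.

Lemma below1_inj p q x y : below p [:: x] = below q [:: y] -> p = q.
Proof.
case: (common_copy p q) => n [u [v [-> ->]]].
by rewrite !below_copy !cats1 => /copy_inj/rcons_inj[->].
Qed.

Lemma rt_parent : exists par : rtree -> rtree,
  forall q, exists x, q = below (par q) [:: x].
Proof.
suff /choice[par parP] : forall q, exists p : rtree, exists x, q = below p [:: x].
  by exists par.
move=> q; rewrite -(copy_surj q); move: (val q) => [n w] /=; rewrite -copyS.
case/lastP: (o :: w) (isT : o :: w != [::]) => // u x _.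
by exists (copy n.+1 u), x; rewrite below_copy cats1.
Qed.

(** The level of [p] is [level_pos p - level_neg p]. *)
Definition level_pos (p : rtree) : nat := size (val p).2.
Definition level_neg (p : rtree) : nat := (val p).1.

Lemma level_copy n w :
  level_pos (copy n w) + n = level_neg (copy n w) + size w.
Proof.
rewrite /level_pos /level_neg /=.
have := reduce_inv n w; case: (reduce n w) => m u [mn ->] /=.
by rewrite size_cat size_nseq addnA subnKC // addnC.
Qed.

Lemma level_below p x :
  level_pos (below p [:: x]) + level_neg p
  = level_neg (below p [:: x]) + (level_pos p).+1.
Proof. by rewrite level_copy size_cat addn1. Qed.
End RegularTree.

Section Ends.
Variable Gr : graph.
Implicit Types (r : nat -> Gr) (E : set (nat -> Gr)).

Fixpoint walk (u v : Gr) (n : nat) : Prop :=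
  if n is n'.+1 then exists2 w, adj u w & walk w v n' else u = v.

Definition geodesic_ray r : Prop :=
  (forall k, adj (r k) (r k.+1)) /\
  forall m n l, m <= n -> walk (r m) (r n) l -> n - m <= l.

Definition eventually_coincide r r' : Prop :=
  exists m n, forall k, r (m + k) = r' (n + k).

Definition end_of r : set (nat -> Gr) :=
  [set r' | geodesic_ray r' /\ eventually_coincide r r'].

Definition is_end E : Prop := exists2 r, geodesic_ray r & E = end_of r.

Definition fix_end E : set (aut Gr) :=
  [set g : aut Gr | [set g \o r | r in E] = E].

Fact fix_end_subgroup E : is_subgroup (fix_end E).
Proof.
have imM (g h : aut Gr) :
    [set (g * h : aut Gr) \o r | r in E]
    = [set h \o r | r in [set g \o r | r in E]].
  by rewrite image_comp.
have im1 : [set (1 : aut Gr) \o r | r in E] = E.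
  by rewrite -[RHS]image_id; apply: eq_imagel => r _; apply/funext.
split=> // [g h gE hE|g gE]; first by rewrite /fix_end /= imM gE hE.
by rewrite /fix_end /= -{1}gE -imM mulgV im1.
Qed.

Definition end_group E : subgroup (aut Gr) := Subgroup (fix_end_subgroup E).

Definition scale_group (W : set (aut Gr)) : Prop :=
  [/\ is_subgroup W, closed W, transitive_on W [set: Gr]
    & exists2 E, is_end E & W `<=` fix_end E].
End Ends.

Section RegularTreeEnd.
Variables (d : nat) (o : 'I_d).

Definition omega : set (nat -> rtree o) := end_of (fun n => copy o n [::] : rtree o).

(** Automorphisms of the regular tree fixing [omega], with the topology of
    pointwise convergence on vertices. *)
Definition aut_omega : subgroup (aut (rtree o)) := end_group omega.

(** The automorphism [h] such that [g (below p w) = below (g p) (h w)] for all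
    [w]; it exists and is unique, see [rt_sectE] and [below_inj]. *)
Definition rt_sect (g : aut_omega) (p : rtree o) : aut (tree d) :=
  xget 1 [set h : aut (tree d) |
          forall w, val g (below p w) = below (val g p) (h w)].

Section SectWellDefined.
Variable par : rtree o -> rtree o.
Hypothesis parP : forall q, exists x, q = below (par q) [:: x].

Let par_below p x : par (below p [:: x]) = p.
Proof. by case: (parP (below p [:: x])) => y /below1_inj. Qed.

Let level_par q :
  level_pos q + level_neg (par q) = level_neg q + (level_pos (par q)).+1.
Proof. by case: (parP q) => x {1 3}->; exact: level_below. Qed.

Let level_iter q m n : m <= n ->
  level_pos (iter m par q) + level_neg (iter n par q)
  = level_neg (iter m par q) + level_pos (iter n par q) + (n - m).
Proof.
move=> /subnKC <-; elim: (n - m) => [|k IHk].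
  by rewrite addn0 subnn addn0 addnC.
rewrite addnS /=; have := level_par (iter (m + k) par q); move: IHk.
set a := iter m par q; set b := iter (m + k) par q; lia.
Qed.

Let level_walk (p q : rtree o) l : walk p q l ->
  level_pos p + level_neg q <= level_neg p + level_pos q + l.
Proof.
elim: l p => [|l IHl] p /=; first by move=> ->; lia.
case=> q' /rt_adjP[] [x qE] /IHl.
  by have := level_below p x; rewrite -qE; lia.
by have := level_below q' x; rewrite -qE; lia.
Qed.

Let ray_omega q : omega (fun k => iter k par q).
Proof.
split; first split.
- move=> k /=; case: (parP (iter k par q)) => x {1}->.
  rewrite -{2}[par _]below0; apply/rt_adj_below; exists x; by right.
- by move=> m n l mn /level_walk; have := level_iter q mn; lia.
have par_copy n : par (copy o n [::]) = copy o n.+1 [::].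
  by rewrite -copyS -(below_copy o _ [::]) par_below.
rewrite -(copy_surj q); move: (val q) => [n w] /=; exists n, (size w).
elim=> [|k IHk]; last by rewrite !addnS /= -IHk par_copy.
rewrite !addn0; elim/last_ind: w => //= w x IHw.
by rewrite size_rcons iterSr -cats1 -below_copy par_below.
Qed.

Lemma aut_omega_child (g : aut_omega) p x :
  exists y, val g (below p [:: x]) = below (val g p) [:: y].
Proof.
pose r k := iter k par (below p [:: x]).
have /bij_inj gI : bijective (val g) by case: (autP (val g)).
have ga u v : adj (val g u) (val g v) <-> adj u v by case: (autP (val g)).
have [_ [M [N gr]]] : omega (val g \o r).
  have <- : [set val g \o r' | r' in omega] = omega by exact: set_mem (valP g).
  by exists r => //; exact: ray_omega.
have {}gr k : val g (r (N + k)) = copy o (M + k) [::] by rewrite (gr k).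
suff /(_ 0) g0 n : par (val g (r n)) = val g (r n.+1).
  case: (parP (val g (r 0))) => y; rewrite g0 /= par_below => gy.
  by exists y.
have [nN|/ltnW nN] := leqP N n.
  rewrite -(subnKC nN) -addnS !gr addnS.
  by rewrite -(copyS o (M + _) [::]) -(below_copy o _ [::]) par_below.
rewrite -(subKn nN); elim: (N - n) (leq_subr n N) => [_|k IHk kN].
  rewrite subn0 -addn1 -[N in r N]addn0 !gr addn1 addn0.
  by rewrite -(copyS o M [::]) -(below_copy o _ [::]) par_below.
move: (IHk (ltnW kN)); rewrite -(subnSK kN); move: (N - k.+1) => m.
move=> IHm; have: adj (r m) (r m.+1).
  by case: (ray_omega (below p [:: x])) => -[+ _] _; exact.
move=> /ga/rt_adjP[] [y gy]; last by rewrite gy par_below.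
move: IHm; rewrite gy par_below => /gI rm.
by have := @level_iter (below p [:: x]) m m.+2; rewrite -!/(r _) -rm; lia.
Qed.
End SectWellDefined.

Lemma rt_sectE (g : aut_omega) p w :
  val g (below p w) = below (val g p) (rt_sect g p w).
Proof.
suff [h hE] : exists h : aut (tree d),
    forall w, val g (below p w) = below (val g p) (h w).
  by rewrite /rt_sect; case: xgetP => [h' _ -> //|/(_ h)[]].
have [par parP] := rt_parent o.
have child (k : aut_omega) q a : exists b, val k (below q a) = below (val k q) b.
  elim/last_ind: a => [|a x [b kb]]; first by exists [::]; rewrite !below0.
  rewrite -cats1 below_cat; have [y ->] := aut_omega_child parP k (below q a) x.
  by rewrite kb -below_cat; exists (b ++ [:: y]).
apply: (@induced_aut (rtree o) d (val g) (below p) (below (val g p))).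
- exact: below_inj.
- exact: below_inj.
- exact: rt_adj_below.
- exact: rt_adj_below.
- by rewrite !below0.
- exact: child.
- move=> a; have [b gb] := child g^-1 (val g p) a; exists b; move: gb.
  have -> : val g^-1 (val g p) = p by rewrite -[LHS]/(val (g * g^-1) p) mulgV.
  by [].
Qed.

Definition pi_root (g : aut_omega) : aut (tree d) := rt_sect g (rt_root o).

Definition stab_root (K : set aut_omega) : set aut_omega :=
  [set g | K g /\ val g (rt_root o) = rt_root o].

Definition ker_pi_root : set aut_omega :=
  [set g | stab_root setT g /\ pi_root g = 1].
End RegularTreeEnd.
Arguments ker_pi_root {d} o _.

(** [fbar] is the extension of [f] by continuity to the closure of [G]; there is
    at most one when the codomain is Hausdorff, and there need not be any when
    [f] is not continuous. *)
Definition extension_by_continuity d (G : subgroup (aut (tree d)))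
    (Y : topologicalType) (f : G -> Y)
    (fbar : closure (G : set (aut (tree d))) -> Y) : Prop :=
  continuous fbar /\ forall g gbar, val gbar = val g -> fbar gbar = f g.

(* Main.v *)
From HB Require Import structures.
Require Import Defs.
From mathcomp Require Import all_boot.
From mathcomp Require Import boolp classical_sets topology.
From mathcomp Require Import zify.

(** Realize [rtree o] as the union of copies of [tree d], the n-th embedded in
    the next one by [w |-> i :: w].  Let [g : G] act on the n-th copy as
    [sigma^n g]; the lifting property makes these actions compatible.  Let [t]
    map the n-th copy onto the next one by the identity.  Then
    [t g t^-1 = sigma g], so this defines an action of the HNN extension, which
    fixes [omega].

    Every element of the HNN extension is of the form [t^-a g t^b].  If it fixes
    the root, then [a = b] and [g] fixes [i^a], and its section at the root is
    that of [g] at [i^a], an element of [G]; this yields injectivity and the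
    structure of the stabilizer of the root.  The closures are handled through
    pointwise approximation on finite sets of vertices. *)

Set Implicit Arguments.
Unset Strict Implicit.
Unset Printing Implicit Defensive.

Local Open Scope classical_set_scope.
Local Open Scope group_scope.

(** * Neighbourhoods for pointwise convergence *)

Section PointwiseTopology.
Variable Gr : graph.
Implicit Types (g h : aut Gr) (A : set (aut Gr)) (s : seq Gr).

Definition agree s g : set (aut Gr) := [set h : aut Gr | {in s, forall v, h v = g v}].

(** The topology is induced by a product of discrete spaces, so the finite conjunctions of
    conditions [h v = g v] give a basis of neighbourhoods of [g]. *)
Lemma aut_nbhsP g U : nbhs g U <-> exists s, agree s g `<=` U.
Proof.
pose T := {ptws vertex Gr -> discrete_topology (vertex Gr)}.
pose fn (h : aut Gr) : T := h.
have fnC : continuous (fn : aut Gr -> T) by exact: initial_continuous.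
split=> [|[s sU]].
  rewrite (@nbhsE (aut Gr)) /= => -[_ [[V oV <-] Vg] VU].
  pose B s : set T := [set f | {in s, forall v, f v = g v}].
  have FF : Filter (filter_from setT B).
    apply: filter_from_filter; first by exists [::].
    move=> s1 s2 _ _; exists (s1 ++ s2) => // f fg.
    by split=> v vs; apply: fg; rewrite mem_cat vs ?orbT.
  (* The product topology is a supremum over the vertices, so convergence is checked one coordinate
     at a time. *)
  have Fg : filter_from setT B --> (fn g : T).
    apply/cvg_sup => v W [_ [[Q _ <-] Qg] QW].
    by exists [:: v] => // f fg; apply: QW; rewrite /= fg ?mem_head.
  have [s _ sV] : filter_from setT B V by apply: Fg; exact: open_nbhs_nbhs.
  by exists s => h hg; apply: VU; apply: sV.
apply: filterS sU _.
elim: s => [|v s IHs].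
  exact: filterS filterT.
have Vv : nbhs g [set h : aut Gr | h v = g v].
  apply: (fnC g [set f : T | f v = g v]).
  pose K (v : vertex Gr) : topologicalType := discrete_topology (vertex Gr).
  exact: (@proj_continuous _ K v (fn g) _ (discrete_set1 _)).
apply: filterS (filterI Vv IHs) => h [hv hs] u.
by rewrite inE => /predU1P[->|/hs].
Qed.

Lemma aut_closureP A g :
  closure A g <-> forall s, exists2 h, A h & {in s, forall v, h v = g v}.
Proof.
split=> [clA s|Ag U /aut_nbhsP[s sU]].
  have /clA[h [Ah hs]] : nbhs g (agree s g) by apply/aut_nbhsP; exists s.
  by exists h.
by have [h Ah hs] := Ag s; exists h; split=> //; exact: sU.
Qed.

End PointwiseTopology.

Section SubspaceTopology.
Variables (Gr : graph) (S : set (aut Gr)).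
Implicit Types (g h : S) (K : set S) (s : seq Gr).

Lemma sub_nbhsP g U : nbhs g U <->
  exists s, forall h, {in s, forall v, val h v = val g v} -> U h.
Proof.
have vC : continuous (val : S -> aut Gr) by exact: initial_continuous.
split=> [|[s sU]].
  rewrite (@nbhsE S) /= => -[_ [[V oV <-] Vg] VU].
  have /aut_nbhsP[s sV] : nbhs (val g) V by exact: open_nbhs_nbhs.
  by exists s => h hs; apply: VU; apply: sV.
have : nbhs g (val @^-1` agree s (val g)).
  by apply: vC; apply/aut_nbhsP; exists s.
by apply: filterS => h hs; apply: sU.
Qed.

Lemma sub_closureP K g :
  closure K g <-> forall s, exists2 h, K h & {in s, forall v, val h v = val g v}.
Proof.
split=> [clA s|Ag U /sub_nbhsP[s sU]].
  have /clA[h [Ah hs]] : nbhs g [set h : S | {in s, forall v, val h v = val g v}].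
    by apply/sub_nbhsP; exists s.
  by exists h.
by have [h Ah hs] := Ag s; exists h; split=> //; exact: sU.
Qed.

End SubspaceTopology.

(** As [f] maps [H] bijectively onto the image of [S], the [h] in [H] with the same image as [x]
    splits [x] as [x * h^-1], in the kernel, times [h]. Multiplicativity is asked on [S] only, to
    suit [pi_root] on the stabilizer of the root. *)
Lemma semidirect_of_retraction (A B : groupType) (S H : set A) (f : A -> B) :
    is_subgroup S -> is_subgroup H -> H `<=` S ->
    (forall x y, S x -> S y -> f (x * y) = f x * f y) ->
    (forall h, H h -> f h = 1 -> h = 1) ->
    (forall x, S x -> exists2 h, H h & f h = f x) ->
  semidirect S [set x | S x /\ f x = 1] H.
Proof.
move=> SS HS HsubS fM fH1 fH; have [S1 SM SV] := SS; have [H1 HM HV] := HS.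
have f1 : f 1 = 1 by apply: (mulgI (f 1)); rewrite -fM // !mulg1.
have fV x : S x -> f x^-1 = (f x)^-1.
  move=> Sx; apply: (mulgI (f x)).
  by rewrite -fM ?mulgV ?f1 //; exact: SV.
split=> //.
- split=> //; split=> // [x y [Sx fx] [Sy fy]|x [Sx fx]].
    by split; [exact: SM|rewrite fM // fx fy mulg1].
  by split; [exact: SV|rewrite fV // fx invg1].
- by split=> // x [].
- move=> s n Ss [Sn fn]; have SVs := SV _ Ss.
  split; first by apply: (SM) => //; exact: SM.
  by rewrite conjgE !fM ?fV //; [rewrite fn mul1g mulVg|exact: SM].
- apply/seteqP; split=> [x [[_ fx] Hx]|_ ->] /=; first exact: fH1.
  by [].
- apply/seteqP; split=> [x Sx|_ [n [Sn _] [h Hh <-]]]; last first.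
    by apply: SM => //; exact: HsubS.
  have [h Hh fhx] := fH _ Sx; have Sh := HsubS _ Hh.
  exists (x * h^-1); last by exists h; rewrite ?mulgVK.
  split; first by apply: SM => //; exact: SV.
  by rewrite fM ?fV ?fhx ?mulgV //; exact: SV.
Qed.

(** * Inverses of automorphisms and closures of subgroups *)

Lemma autK (Gr : graph) (g : aut Gr) : cancel g (g^-1 : aut Gr).
Proof. by move=> v; rewrite -[LHS]/((g * g^-1 : aut Gr) v) mulgV. Qed.

Lemma autVK (Gr : graph) (g : aut Gr) : cancel (g^-1 : aut Gr) g.
Proof. by move=> v; rewrite -[LHS]/((g^-1 * g : aut Gr) v) mulVg. Qed.

Lemma aut_adj (Gr : graph) (g : aut Gr) u v : adj (g u) (g v) <-> adj u v.
Proof. by case: (autP g). Qed.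

Lemma closure_subgroup (Gr : graph) (A : set (aut Gr)) :
  is_subgroup A -> is_subgroup (closure A).
Proof.
case=> A1 AM AV; split.
- by apply/aut_closureP => s; exists 1.
- move=> x y /aut_closureP clx /aut_closureP cly; apply/aut_closureP => s.
  (* The product sends [v] to [y (x v)], so [y] is approximated on the images under [x]. *)
  have [h Ah hx] := clx s; have [k Ak ky] := cly (map x s).
  exists (h * k); first exact: AM.
  by move=> v vs; rewrite /= hx // ky // map_f.
- move=> x /aut_closureP clx; apply/aut_closureP => s.
  have [h Ah hx] := clx (map (x^-1 : aut Gr) s).
  exists h^-1; first exact: AV.
  move=> v vs; apply: (can_inj (autK h)).
  by rewrite autVK hx ?autVK // map_f.
Qed.

Section SubClosure.
Variables (Gr : graph) (S : subgroup (aut Gr)) (K : set S).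

Lemma sub_closureE g : closure K g <-> closure [set val k | k in K] (val g).
Proof.
rewrite sub_closureP aut_closureP; split=> Kg s; have [h Kh hs] := Kg s.
  by exists (val h) => //; exists h.
by case: Kh hs => k Kk <- hs; exists k.
Qed.

Lemma sub_closure_subgroup : is_subgroup K -> is_subgroup (closure K).
Proof.
case=> K1 KM KV.
have [|c1 cM cV] := @closure_subgroup Gr [set val k | k in K].
  split; first by exists 1.
    by move=> _ _ [x Kx <-] [y Ky <-]; exists (x * y) => //; exact: KM.
  by move=> _ [x Kx <-]; exists x^-1; [exact: KV|].
split.
- exact/sub_closureE.
- move=> x y /sub_closureE cx /sub_closureE cy; apply/sub_closureE; exact: cM.
- by move=> x /sub_closureE cx; apply/sub_closureE; exact: cV.
Qed.

End SubClosure.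

Lemma walk_aut (Gr : graph) (g : aut Gr) u v l :
  walk (g u) (g v) l <-> walk u v l.
Proof.
elim: l u => [|l IHl] u /=; first by split=> [/(can_inj (autK g))|->].
split=> -[w uw wv].
  exists ((g^-1 : aut Gr) w); first by rewrite -(aut_adj g) autVK.
  by rewrite -IHl autVK.
by exists (g w); [apply/aut_adj|apply/IHl].
Qed.

(** * The end [omega] *)

Section Omega.
Variables (d : nat) (o : 'I_d).
Implicit Types (g : aut (rtree o)) (p q : rtree o).
Let spine n : rtree o := copy o n [::].

Lemma copy_spine n : spine n = below (spine n.+1) [:: o].
Proof. by rewrite below_copy /= copyS. Qed.

Let omega_shift g m n r : (forall k, g (spine (m + k)) = spine (n + k)) ->
  @omega d o r -> @omega d o (g \o r).
Proof.
move=> gmn [[ra rg] [a [b rab]]]; split; first split.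
- by move=> k; apply/aut_adj.
- by move=> u v l uv /walk_aut; exact: rg.
(* From [spine (a + k) = r (b + k)] one gets [g (r (b + m + k)) = g (spine (m + (a + k))) = spine (n
   + a + k)]. *)
exists (n + a), (b + m) => k.
rewrite -[LHS]/(spine (n + a + k)) /comp -!addnA -rab -gmn -/(spine _).
by congr (g (spine _)); rewrite addnCA.
Qed.

(** A ray of [omega] eventually follows the spine, whose far part is shifted along itself by [g].
    The inverse shifts it back, with [m] and [n] exchanged, which gives the other inclusion. *)
Lemma fix_omega_spine g m n :
  (forall k, g (spine (m + k)) = spine (n + k)) -> fix_end (@omega d o) g.
Proof.
move=> gmn; apply/seteqP; split=> [_ [r ro <-]|r ro]; first exact: omega_shift ro.
exists ((g^-1 : aut _) \o r); last by apply/funext => k; rewrite /= autVK.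
by apply: (@omega_shift _ n m) ro => k; rewrite -gmn autK.
Qed.

(** This criterion only involves the values of [g] at two vertices at a time, so
    the stabilizer of [omega] is closed under pointwise limits. *)
Lemma fix_omega_child g :
    (forall p x, exists y, g (below p [:: x]) = below (g p) [:: y]) ->
  fix_end (@omega d o) g.
Proof.
move=> gc.
have up a b u x : g (spine a) = copy o b (rcons u x) -> g (spine a.+1) = copy o b u.
  have [y] := gc (spine a.+1) o; rewrite -copy_spine => -> gab.
  by apply: (@below1_inj _ o _ _ y x); rewrite gab below_copy cats1.
(* Each step up the spine removes the last letter of the word [u] that locates the image in the copy
   [n]; once [u] is empty, the image is on the spine. *)
have [m [n gmn]] : exists m n, g (spine m) = spine n.
  have : exists m n u, g (spine m) = copy o n u.
    by exists 0, (val (g (spine 0))).1, (val (g (spine 0))).2; rewrite copy_surj.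
  case=> m [n [u]]; elim/last_ind: u m => [|u x IHu] m gm; first by exists m, n.
  by apply: (IHu m.+1); exact: up gm.
apply: (@fix_omega_spine _ m n); elim=> [|k IHk]; first by rewrite !addn0.
by rewrite !addnS; apply: (up _ _ [::] o); rewrite IHk copy_spine below_copy.
Qed.

Lemma aut_omega_below (g : aut_omega o) p x :
  exists y, val g (below p [:: x]) = below (val g p) [:: y].
Proof. by have [par parP] := rt_parent o; exact: aut_omega_child. Qed.

(** An edge changes the level by one; levels are differences, so terms are moved across to avoid
    subtraction in [nat]. *)
Lemma walk_level p q l : walk p q l ->
  level_pos p + level_neg q <= level_neg p + level_pos q + l.
Proof.
elim: l p => [|l IHl] p /=; first by move=> ->; lia.
case=> q' /rt_adjP[] [x qE] /IHl.
  by have := level_below p x; rewrite -qE; lia.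
by have := level_below q' x; rewrite -qE; lia.
Qed.

Lemma omega_is_end : is_end (@omega d o).
Proof.
exists spine => //; split.
  move=> k; rewrite copy_spine -{2}(below0 (spine k.+1)).
  by apply/rt_adj_below; exists o; right.
move=> m n l _ /walk_level; rewrite /level_pos /level_neg.
have E k : val (spine k) = (k, [::]) by case: k.
by rewrite !E /=; lia.
Qed.

End Omega.

(** * Copies of the rooted tree along the letter [i] *)

Section Relabel.
Variable d : nat.
Implicit Types (a b x : 'I_d) (w : word d).

(** An automorphism of [tree d] which maps [nseq k a] to [nseq k b] for [k <= n]
    and changes labels only next to that path. *)
Fixpoint relabel a b n w : word d :=
  match n, w with
  | n'.+1, x :: w' =>
      if x == a then b :: relabel a b n' w' else (if x == b then a else x) :: w'
  | _, _ => w
  end.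

Lemma relabelK a b n : cancel (relabel a b n) (relabel b a n).
Proof.
elim: n => [|n IHn] [|x w] //=; case: (eqVneq x a) => [->|xa] /=.
  by rewrite eqxx IHn.
case: (eqVneq x b) xa => [->|xb] xa; last by rewrite (negbTE xb) (negbTE xa).
by rewrite eq_sym (negbTE xa) eqxx.
Qed.

Lemma relabel_rcons a b n w x :
  exists y, relabel a b n (rcons w x) = rcons (relabel a b n w) y.
Proof.
elim: n w => [|n IHn] [|z w] /=; try by exists x.
- case: ifP => _; first by exists b; case: n {IHn}.
  by exists (if x == b then a else x).
- case: ifP => _; last by exists x.
  by have [y ->] := IHn w; exists y.
Qed.

Lemma relabel_adj a b n v w :
  word_adj (relabel a b n v) (relabel a b n w) <-> word_adj v w.
Proof.
have imp a' b' v' w' :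
    word_adj v' w' -> word_adj (relabel a' b' n v') (relabel a' b' n w').
  case=> x [] ->; [have [y ->] := relabel_rcons a' b' n v' x|
                   have [y ->] := relabel_rcons a' b' n w' x]; exists y; auto.
by split=> [/(imp b a)|]; [rewrite !relabelK|exact: imp].
Qed.

End Relabel.

Section Chart.
Variables (d : nat) (o i : 'I_d).
Implicit Types (v w : word d) (p q : rtree o).

(** The trees [chart n] exhaust [rtree o] and [chart n] is embedded in
    [chart n.+1] by [w |-> i :: w] instead of [w |-> o :: w].  As [chart 0] is
    [copy o 0], the change of labels is not visible below [rt_root o]. *)
Definition chart n w : rtree o := copy o n (relabel i o n w).

Lemma chart0 w : chart 0 w = below (rt_root o) w.
Proof. by rewrite below_copy. Qed.

Lemma chart_nil n : chart n [::] = copy o n [::].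
Proof. by case: n. Qed.

Lemma chartS n w : chart n.+1 (i :: w) = chart n w.
Proof. by rewrite /chart /= eqxx copyS. Qed.

Lemma chart_shift k n w : chart (k + n) (nseq k i ++ w) = chart n w.
Proof. by elim: k => //= k IHk; rewrite addSn chartS. Qed.

Lemma chart_inj n : injective (chart n).
Proof. by move=> v w /copy_inj/(can_inj (relabelK i o n)). Qed.

Lemma chart_copy n w : copy o n w = chart n (relabel o i n w).
Proof. by rewrite /chart relabelK. Qed.

Lemma chart_surj p : exists n w, p = chart n w.
Proof.
by exists (val p).1, (relabel o i (val p).1 (val p).2); rewrite -chart_copy copy_surj.
Qed.

Lemma chart_common p q : exists n v w, p = chart n v /\ q = chart n w.
Proof.
have [n [v [w [-> ->]]]] := common_copy p q.
by exists n, (relabel o i n v), (relabel o i n w); rewrite -!chart_copy.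
Qed.

Lemma chart_adj n v w : rt_adj (chart n v) (chart n w) <-> word_adj v w.
Proof. by rewrite /chart rt_adj_copy; exact: relabel_adj. Qed.

Lemma chart_glue T (F : nat -> word d -> T) :
    (forall n w, F n.+1 (i :: w) = F n w) ->
  exists f : rtree o -> T, forall n w, f (chart n w) = F n w.
Proof.
move=> FS; have FA k n w : F (k + n) (nseq k i ++ w) = F n w.
  by elim: k => //= k IHk; rewrite addSn FS.
have /choice[nw nwP] : forall p, exists x : nat * word d, p = chart x.1 x.2.
  by move=> p; have [n [w ->]] := chart_surj p; exists (n, w).
exists (fun p => F (nw p).1 (nw p).2) => n w.
(* Both charts that show this vertex embed in the chart [m + n], where its word is unique. *)
have := nwP (chart n w); case: (nw _) => m u /= E.
rewrite -(FA n m) -(FA m n) addnC; congr F; apply: (@chart_inj (m + n)).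
by rewrite chart_shift addnC chart_shift.
Qed.

(** Since [f] shifts the spine by [a], it fixes [omega]; the shift is 0 for elements of [G] and 1
    for the stable letter. *)
Lemma chart_aut_omega (f f' : rtree o -> rtree o) a :
    cancel f f' -> cancel f' f ->
    (forall n v w, rt_adj (f (chart n v)) (f (chart n w)) <-> word_adj v w) ->
    (forall n, f (chart n [::]) = chart (a + n) [::]) ->
  exists g : aut_omega o, forall p, val g p = f p.
Proof.
move=> fK f'K fa f0.
have fP : is_aut (Gr := rtree o) f.
  split=> [|p q|//]; first by exists f'.
  have [n [v [w [-> ->]]]] := chart_common p q.
  by rewrite /= fa chart_adj.
suff fo : fix_end (@omega d o) (Aut fP).
  by exists (SigSub (mem_set fo : Aut fP \in (aut_omega o : set _))).
apply: (@fix_omega_spine _ _ _ 0 a) => k.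
by rewrite -!chart_nil /= f0.
Qed.

End Chart.

(** * Ascending HNN extensions *)

Section HNNWords.
Variables (G : groupType) (s : {multiplicative G -> G}).

Lemma hnn_classM u v : hnn_class s (u ++ v) = hnn_class s u * hnn_class s v.
Proof.
apply/hnn_classP/hnn_sym; apply: hnn_cat; exact: hnn_repr.
Qed.

Lemma hnn_baseM g h : hnn_base s (g * h) = hnn_base s g * hnn_base s h.
Proof. by rewrite -hnn_classM; apply/hnn_classP/hnn_sym; exact: hnn_eqM. Qed.

Lemma hnn_base1 : hnn_base s 1 = 1.
Proof. by apply/hnn_classP; exact: hnn_eq1. Qed.

Definition hnn_t : hnn s := hnn_class s [:: inr true].

Lemma hnn_tV : hnn_t^-1 = hnn_class s [:: inr false].
Proof.
apply: mulg1_eq; rewrite -hnn_classM; apply/hnn_classP; exact: hnn_eqtV.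
Qed.

Lemma hnn_tJ g : hnn_t * hnn_base s g = hnn_base s (s g) * hnn_t.
Proof.
apply: (mulIg hnn_t^-1); rewrite mulgK hnn_tV /hnn_t /hnn_base -!hnn_classM.
by apply/hnn_classP; exact: hnn_eqJ.
Qed.

Lemma hnn_tXJ n g :
  hnn_t ^+ n * hnn_base s g = hnn_base s (iter n s g) * hnn_t ^+ n.
Proof.
elim: n => [|n IHn]; first by rewrite expg0 mulg1 mul1g.
by rewrite !expgS -mulgA IHn !mulgA hnn_tJ.
Qed.

(** Left multiplication by a letter preserves the form: an element of [G] crosses [hnn_t ^- a] and
    becomes its image under [iter a s], while [hnn_t] cancels against [hnn_t ^- a] or, when [a = 0],
    crosses [g] and turns it into [s g]. *)
Lemma hnn_normal_form (x : hnn s) :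
  exists a g b, x = hnn_t ^- a * hnn_base s g * hnn_t ^+ b.
Proof.
rewrite -(hnn_classK x); elim: (repr x) => [|l u [a [g [b IHu]]]].
  exists 0, 1, 0; rewrite expg0 mulg1 hnn_base1 invg1 mulg1.
  by [].
rewrite -cat1s hnn_classM IHu; case: l => [h|[]].
- exists a, (iter a s h * g), b.
  rewrite hnn_baseM !mulgA; congr (_ * _ * _).
  by apply: (mulgI (hnn_t ^+ a)); rewrite !mulgA hnn_tXJ mulgK mulgV mul1g.
- rewrite -/hnn_t; case: a {IHu} => [|a].
    exists 0, (s g), b.+1.
    by rewrite expg0 invg1 !mul1g expgS mulgA hnn_tJ -mulgA.
  exists a, g, b; rewrite expgSr invgM !mulgA; congr (_ * _ * _).
  by rewrite mulgV mul1g.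
exists a.+1, g, b.
by rewrite -hnn_tV expgSr invgM !mulgA.
Qed.

End HNNWords.

Section HNNLift.
Variables (G H : groupType) (s : {multiplicative G -> G}).
Variables (f : G -> H) (t : H).
Hypotheses (fM : {morph f : x y / x * y}) (ft : forall g, t * f g * t^-1 = f (s g)).

Let letter (a : G + bool) : H :=
  match a with inl g => f g | inr true => t | inr false => t^-1 end.
Let eval (u : hnn_word G) : H := foldr (fun a x => letter a * x) 1 u.

Let eval_cat u v : eval (u ++ v) = eval u * eval v.
Proof. by elim: u => [|a u IHu] /=; rewrite ?mul1g // IHu mulgA. Qed.

Let eval_eq u v : hnn_eq s u v -> eval u = eval v.
Proof.
elim=> //= {u v}.
- by move=> u v w _ -> _ ->.
- by move=> u u' v v' _ uE _ vE; rewrite !eval_cat uE vE.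
- by rewrite mulg1; apply: (mulgI (f 1)); rewrite -fM !mulg1.
- by move=> g h; rewrite fM !mulg1.
- by rewrite mulg1 mulgV.
- by rewrite mulg1 mulVg.
- by move=> g; rewrite !mulg1 mulgA ft.
Qed.

(** The universal property of the presentation: evaluation of words in [H] respects the relations
    and descends to the quotient. *)
Lemma hnn_lift : exists2 theta : {multiplicative hnn s -> H},
  forall g, theta (hnn_base s g) = f g & theta (hnn_t s) = t.
Proof.
pose th (x : hnn s) := eval (repr x).
have thE u : th (hnn_class s u) = eval u by apply: eval_eq; exact: hnn_repr.
have thM : {morph th : x y / x * y} by move=> x y; rewrite thE eval_cat.
pose theta : {multiplicative hnn s -> H} :=
  HB.pack th (isMultiplicative.Build _ _ th thM).
by exists theta => [g|]; rewrite /theta /= thE /= mulg1.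
Qed.

End HNNLift.

Lemma multiplicative1 (G H : groupType) (f : {multiplicative G -> H}) : f 1 = 1.
Proof. by apply: (mulgI (f 1)); rewrite -gmulfM !mulg1. Qed.

Lemma multiplicativeV (G H : groupType) (f : {multiplicative G -> H}) x :
  f x^-1 = (f x)^-1.
Proof. by apply: (mulgI (f x)); rewrite -gmulfM !mulgV multiplicative1. Qed.

Lemma range_subgroup (G H : groupType) (f : {multiplicative G -> H}) :
  is_subgroup (range f).
Proof.
split; first by exists 1 => //; exact: multiplicative1.
  by move=> _ _ [x _ <-] [y _ <-]; exists (x * y) => //; exact: gmulfM.
by move=> _ [x _ <-]; exists x^-1 => //; exact: multiplicativeV.
Qed.

(** An ultrafilter contains one piece of every finite partition. *)
Lemma ultra_finite_range (T : Type) (T' : eqType) (U : set_system T) (f : T -> T')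
    (s : seq T') :
  UltraFilter U -> (forall t, f t \in s) -> exists y, U [set t | f t = y].
Proof.
move=> UU fs; have : U [set t | f t \in s] by apply: filterS filterT => t _; exact: fs.
elim: s {fs} => [|y s IHs] Us.
  by have [t] := filter_ex Us.
have [Uy|Uy] := in_ultra_setVsetC [set t | f t = y] UU; first by exists y.
apply: IHs; apply: filterS (filterI Us Uy) => t [] /=.
by rewrite inE => /predU1P[].
Qed.

(** * The action of the HNN extension *)

Section TreeAut.
Variable d : nat.
Implicit Types (g h : aut (tree d)) (v w : word d).

Lemma aut_word_nil g : g [::] = [::].
Proof. by case: (autP g) => _ _; exact. Qed.

Lemma aut_word_size g w : size (g w) = size w.
Proof.
elim/last_ind: w => [|w x IHw]; first by rewrite aut_word_nil.
by have [y ->] := aut_word_rcons g w x; rewrite !size_rcons IHw.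
Qed.

Lemma sect_eq g v h : (forall w, g (v ++ w) = g v ++ h w) -> sect g v = h.
Proof.
by move=> gh; apply: aut_ext => w; apply: (@cat_injl _ (g v)); rewrite -sectE gh.
Qed.

Lemma sect_cat g v w : sect g (v ++ w) = sect (sect g v) w.
Proof. by apply: sect_eq => u; rewrite -catA !sectE catA. Qed.

Lemma sect_mul g h v : sect (g * h) v = sect g v * sect h (g v).
Proof. by apply: sect_eq => u; rewrite /= !sectE. Qed.

End TreeAut.

Section Lifting.
Variables (d : nat) (G : subgroup (aut (tree d))) (i : 'I_d).
Variable sigma : {multiplicative G -> G}.
Hypotheses (ssG : self_similar G) (sigmaP : is_lifting i sigma).
Implicit Types g h : G.

(** Hence the action of [iter n.+1 sigma g] on [chart n.+1] extends that of [iter n sigma g] on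
    [chart n]. *)
Lemma lifting_cons g w : val (sigma g) (i :: w) = i :: val g w.
Proof. by have [gi sgi] := sigmaP g; rewrite -cat1s sectE gi sgi. Qed.

Lemma liftingM n : {morph iter n sigma : g h / g * h}.
Proof. by elim: n => // n IHn g h; rewrite !iterS IHn gmulfM. Qed.

Lemma lifting1 n : iter n sigma 1 = 1.
Proof. by elim: n => // n IHn; rewrite iterS IHn multiplicative1. Qed.

Let subG (g : aut (tree d)) (Gg : (G : set _) g) : G := SigSub (mem_set Gg).

(** Induction on [v]: transitivity gives [h] mapping the first letter [x] to [i], and conjugating
    lifted elements by [h] gives elements that fix [x] and have a prescribed section there. *)
Lemma lifting_self_replicating : level1_transitive G -> self_replicating G.
Proof.
move=> trG; split=> // v; apply/seteqP; split=> [_ [g [Gg _] <-]|g Gg].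
  exact: ssG.
elim: v g Gg => [|x v IHv] g Gg.
  exists g; first by split=> //; exact: aut_word_nil.
  by apply: sect_eq => w; rewrite aut_word_nil.
have [k [Gk kv] <-] := IHv g Gg.
have [G1 GM GV] := subgroup_setP G.
have [h Gh hx] : exists2 h, (G : set _) h & h [:: x] = [:: i].
  by apply: trG; [exists x|exists i].
(* The section of [h * b * h^-1] at [x] is [a * sect b [:: i] * a^-1]; to make it [k], [b] is the
   lift of [a^-1 * k * a]. *)
pose a := sect h [:: x]; have Ga : (G : set _) a by exact: ssG.
have Gb : (G : set _) (a^-1 * k * a) by apply: (GM) => //; apply: (GM) => //; exact: GV.
have [bi sb] := sigmaP (subG Gb); set b := val (sigma _) in bi sb.
have hVi : (h^-1 : aut _) [:: i] = [:: x] by rewrite -hx autK.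
have shV : sect h^-1 [:: i] = a^-1.
  apply: (mulgI a); rewrite mulgV -hx -sect_mul mulgV.
  exact: sect_eq.
pose f := h * b * h^-1.
have fx : f [:: x] = [:: x] by rewrite /= hx bi hVi.
have sf : sect f [:: x] = k.
  by rewrite !sect_mul -/a /= hx bi sb shV /= !mulgA mulgV mul1g mulgK.
exists f; last by rewrite -cat1s sect_cat sf.
split; last by rewrite -cat1s sectE fx sf kv.
apply: (GM); last exact: GV.
by apply: (GM) => //; exact: set_mem (valP (sigma (subG Gb))).
Qed.

Variable o : 'I_d.
Local Notation chart := (chart o i).

Lemma aut_omega_ext (k l : aut_omega o) :
  (forall n w, val k (chart n w) = val l (chart n w)) -> k = l.
Proof.
move=> kl; apply: val_inj; apply: aut_ext => p.
by have [n [w ->]] := chart_surj i p.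
Qed.

Lemma base_action g : exists k : aut_omega o,
  forall n w, val k (chart n w) = chart n (val (iter n sigma g) w).
Proof.
have glue h : exists f : rtree o -> rtree o,
    forall n w, f (chart n w) = chart n (val (iter n sigma h) w).
  by apply: chart_glue => n w; rewrite iterS lifting_cons chartS.
have [f fE] := glue g; have [f' f'E] := glue g^-1.
have cK h h' n w : h * h' = 1 -> val (iter n sigma h') (val (iter n sigma h) w) = w.
  move=> hh; rewrite -[LHS]/(val (iter n sigma h * iter n sigma h') w).
  by rewrite -liftingM hh lifting1.
have [] := @chart_aut_omega d o i f f' 0.
- move=> p; have [n [w ->]] := chart_surj i p.
  by rewrite fE f'E cK // mulgV.
- move=> p; have [n [w ->]] := chart_surj i p.
  by rewrite f'E fE cK // mulVg.
- move=> n v w; rewrite !fE chart_adj; exact: (aut_adj (Gr := tree d)).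
- by move=> n; rewrite fE aut_word_nil.
by move=> k kE; exists k => n w; rewrite kE fE.
Qed.

(** The inverse map stays in the chart and prepends [i], since [chart n.+1 (i :: w) = chart n w]. *)
Lemma stable_action : exists k : aut_omega o,
  forall n w, val k (chart n w) = chart n.+1 w.
Proof.
have [f fE] : exists f : rtree o -> rtree o,
    forall n w, f (chart n w) = chart n.+1 w.
  by apply: chart_glue => n w; rewrite chartS.
have [f' f'E] : exists f' : rtree o -> rtree o,
    forall n w, f' (chart n w) = chart n (i :: w).
  by apply: chart_glue => n w; rewrite chartS.
have [] := @chart_aut_omega d o i f f' 1.
- move=> p; have [n [w ->]] := chart_surj i p.
  by rewrite fE f'E chartS.
- move=> p; have [n [w ->]] := chart_surj i p.
  by rewrite f'E fE chartS.
- by move=> n v w; rewrite !fE chart_adj.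
- by move=> n; rewrite fE.
by move=> k kE; exists k => n w; rewrite kE fE.
Qed.

Lemma hnn_action : exists theta : {multiplicative hnn sigma -> aut_omega o},
  (forall g n w, val (theta (hnn_base sigma g)) (chart n w)
                 = chart n (val (iter n sigma g) w)) /\
  (forall n w, val (theta (hnn_t sigma)) (chart n w) = chart n.+1 w).
Proof.
have [f fE] := choice base_action; have [t tE] := stable_action.
have fM : {morph f : g h / g * h}.
  move=> g h; apply: aut_omega_ext => n w.
  by rewrite fE liftingM /= !fE.
(* Products act from left to right: [t] moves to [chart n.+1], where [g] acts as
   [iter n.+1 sigma g], which is the action of [sigma g] on [chart n]. *)
have ft g : t * f g * t^-1 = f (sigma g).
  apply: (mulIg t); rewrite mulgVK; apply: aut_omega_ext => n w.
  by rewrite /= tE !fE tE -iterSr.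
have [theta thb tht] := hnn_lift fM ft.
by exists theta; split=> [g|] n w; rewrite ?thb ?tht.
Qed.

End Lifting.

(** * Stabilizers of the root and closures *)

Section RootProjection.
Variables (d : nat) (o : 'I_d).
Implicit Types k l : aut_omega o.
Local Notation root := (rt_root o).

Lemma pi_rootE k w :
  val k root = root -> val k (below root w) = below root (pi_root k w).
Proof. by move=> kr; rewrite rt_sectE kr. Qed.

Lemma pi_root_eq k (h : aut (tree d)) :
    val k root = root ->
    (forall w, val k (below root w) = below root (h w)) ->
  pi_root k = h.
Proof.
by move=> kr kh; apply: aut_ext => w; apply: (@below_inj _ o root); rewrite -pi_rootE.
Qed.

Lemma pi_rootM k l : val k root = root -> val l root = root ->
  pi_root (k * l) = pi_root k * pi_root l.
Proof.
move=> kr lr; apply: pi_root_eq => [|w]; first by rewrite /= kr.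
rewrite -[LHS]/(val l (val k (below root w))).
by rewrite (pi_rootE _ kr) (pi_rootE _ lr).
Qed.

Lemma pi_root1 : pi_root (1 : aut_omega o) = 1.
Proof. exact: pi_root_eq. Qed.

Lemma stab_root_subgroup (K : set (aut_omega o)) :
  is_subgroup K -> is_subgroup (stab_root K).
Proof.
case=> K1 KM KV; split; first by split.
  by move=> x y [Kx xr] [Ky yr]; split; [exact: KM|rewrite /= xr].
move=> x [Kx xr]; split; first exact: KV.
by rewrite -{1}xr -[LHS]/(val (x * x^-1) root) mulgV.
Qed.

Lemma ker_pi_rootI (K : set (aut_omega o)) :
  ker_pi_root o `&` K = [set x | stab_root K x /\ pi_root x = 1].
Proof. by apply/seteqP; split=> x; [case=> -[[_ ?] ?] ?|case=> -[? ?] ?]. Qed.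

Lemma semidirect_pi_root (K H : set (aut_omega o)) :
    is_subgroup K -> is_subgroup H -> H `<=` stab_root K ->
    (forall h, H h -> pi_root h = 1 -> h = 1) ->
    (forall x, stab_root K x -> exists2 h, H h & pi_root h = pi_root x) ->
  semidirect (stab_root K) (ker_pi_root o `&` K) H.
Proof.
move=> KS HS HK H1 HE; rewrite ker_pi_rootI; apply: semidirect_of_retraction => //.
  exact: stab_root_subgroup.
by move=> x y [_ xr] [_ yr]; exact: pi_rootM.
Qed.

End RootProjection.

(** * Faithfulness, stabilizer of the root, transitivity and closure of the image *)

Section Representation.
Variables (d : nat) (G : subgroup (aut (tree d))) (i o : 'I_d).
Variable sigma : {multiplicative G -> G}.
Hypotheses (ssG : self_similar G) (sigmaP : is_lifting i sigma).
Variable theta : {multiplicative hnn sigma -> aut_omega o}.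
Local Notation chart := (chart o i).
Local Notation thG g := (theta (hnn_base sigma g)).
Local Notation tt := (hnn_t sigma).
Hypothesis thGE : forall g n w,
  val (thG g) (chart n w) = chart n (val (iter n sigma g) w).
Hypothesis thtE : forall n w, val (theta tt) (chart n w) = chart n.+1 w.
Implicit Types (g h : G) (p q : rtree o) (s : seq (tree d)) (r : seq (rtree o)).
Local Notation root := (rt_root o).

Let subG (g : aut (tree d)) (Gg : (G : set _) g) : G := SigSub (mem_set Gg).

Let thGM g h : thG (g * h) = thG g * thG h.
Proof. by rewrite hnn_baseM gmulfM. Qed.

Let thG1 : thG 1 = 1.
Proof. by rewrite hnn_base1 multiplicative1. Qed.

Let thGV g : thG g^-1 = (thG g)^-1.
Proof. by apply: (mulgI (thG g)); rewrite -thGM !mulgV thG1. Qed.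

Let thGK g : cancel (val (thG g)) (val (thG g^-1)).
Proof. by move=> p; rewrite -[LHS]/(val (thG g * thG g^-1) p) -thGM mulgV thG1. Qed.

Let thGVK g : cancel (val (thG g^-1)) (val (thG g)).
Proof. by move=> p; rewrite -[LHS]/(val (thG g^-1 * thG g) p) -thGM mulVg thG1. Qed.

Let root_chart : root = chart 0 [::].
Proof. by rewrite chart0 below0. Qed.

Let thG0 g w : val (thG g) (chart 0 w) = chart 0 (val g w).
Proof. exact: thGE. Qed.

Let thG_root g : val (thG g) root = root.
Proof. by rewrite root_chart thG0 aut_word_nil. Qed.

Lemma pi_root_base g : pi_root (thG g) = val g.
Proof. by apply: pi_root_eq => // w; rewrite -!(chart0 o i) thG0. Qed.

Let thtXE a n w : val (theta (tt ^+ a)) (chart n w) = chart (a + n) w.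
Proof.
elim: a n => [|a IHa] n; first by rewrite expg0 multiplicative1.
by rewrite expgS gmulfM /= thtE IHa addnS.
Qed.

Let thtXVE a n w : val (theta (tt ^- a)) (chart n w) = chart n (nseq a i ++ w).
Proof.
rewrite -(chart_shift o i a n w) -thtXE multiplicativeV.
by rewrite -[LHS]/(val (theta (tt ^+ a) * (theta (tt ^+ a))^-1) _) mulgV.
Qed.

Let theta_normal a g b w :
  val (theta (tt ^- a * hnn_base sigma g * tt ^+ b)) (chart 0 w)
  = chart b (val g (nseq a i ++ w)).
Proof. by rewrite !gmulfM /= thtXVE thG0 thtXE addn0. Qed.

Lemma theta_stab_root x : val (theta x) root = root ->
  exists a g, x = tt ^- a * hnn_base sigma g * tt ^+ a /\
    pi_root (theta x) = sect (val g) (nseq a i).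
Proof.
move=> xr; have [a [g [b xE]]] := hnn_normal_form x.
(* The root is also [chart b (nseq b i)], and words in one chart can be compared. *)
have gab : val g (nseq a i) = nseq b i.
  apply: (@chart_inj d o i b); move: xr.
  by rewrite xE root_chart theta_normal cats0 -(chart_shift o i b 0 [::])
    addn0 cats0.
have ab : a = b by rewrite -(size_nseq a i) -(aut_word_size (val g)) gab size_nseq.
exists a, g; rewrite {1}xE -ab; split=> //; apply: pi_root_eq => // w.
rewrite -!(chart0 o i) xE theta_normal sectE gab.
by rewrite -(chart_shift o i b 0) addn0 ab.
Qed.

Lemma theta_inj : injective theta.
Proof.
suff inj1 x : theta x = 1 -> x = 1.
  move=> x y xy; apply: (mulIg y^-1); rewrite mulgV; apply: inj1.
  by rewrite gmulfM multiplicativeV xy mulgV.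
move=> x1; have [|a [g [xE _]]] := @theta_stab_root x; first by rewrite x1.
(* A conjugate of [thG g] is trivial, so [thG g] is; its section at the root recovers [g]. *)
have th1 : thG g = 1.
  have := congr1 theta xE; rewrite x1 !gmulfM multiplicativeV -mulgA -conjgE.
  by move/esym/eqP; rewrite conjg_eq1 => /eqP.
have g1 : g = 1 by apply: val_inj; rewrite -pi_root_base th1 pi_root1.
by rewrite xE g1 hnn_base1 mulg1 mulVg.
Qed.

Let K : set (aut_omega o) := range theta.
Let W := closure K.
Let Gbar := closure (G : set (aut (tree d))).

Let KS : is_subgroup K.
Proof. exact: range_subgroup. Qed.

Let WS : is_subgroup W.
Proof. exact: sub_closure_subgroup. Qed.

Lemma pi_root_stab : [set pi_root k | k in stab_root K] = G.
Proof.
apply/seteqP; split=> [_ [_ [[x _ <-] xr] <-]|g Gg].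
  by have [a [g [_ ->]]] := theta_stab_root xr; apply: ssG; exact: set_mem (valP g).
exists (thG (subG Gg)); last exact: pi_root_base.
by split; [exists (hnn_base sigma (subG Gg))|].
Qed.

Lemma semidirect_stab :
  semidirect (stab_root K) (ker_pi_root o `&` K) (range (fun g => thG g)).
Proof.
apply: semidirect_pi_root => //.
- split; first by exists 1.
    by move=> _ _ [g _ <-] [h _ <-]; exists (g * h).
  by move=> _ [g _ <-]; exists g^-1; rewrite ?thGV.
- by move=> _ [g _ <-]; split; [exists (hnn_base sigma g)|].
- by move=> _ [g _ <-]; rewrite pi_root_base => g1;
    rewrite (_ : g = 1) ?thG1 //; exact: val_inj.
- move=> x xS; have : (G : set _) (pi_root x) by rewrite -pi_root_stab; exists x.
  by move=> Gx; exists (thG (subG Gx)); [exists (subG Gx)|rewrite pi_root_base].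
Qed.

Lemma theta_transitive : level1_transitive G ->
  transitive_on [set val k | k in K] [set: rtree o].
Proof.
move=> trG.
suff toroot p : exists2 k, K k & val k p = root.
  move=> p q _ _; have [k Kk kp] := toroot p; have [l Kl lq] := toroot q.
  have [_ KM KV] := KS.
  exists (val (k * l^-1)); first by exists (k * l^-1) => //; apply: KM => //; exact: KV.
  by rewrite /= kp -lq -[LHS]/(val (l * l^-1) q) mulgV.
have [n [w ->]] := chart_surj i p.
(* As [tt ^- n] maps [chart n w] to [chart 0 w], only vertices below the root remain. *)
suff toroot0 v : exists2 k, K k & val k (chart 0 v) = root.
  have [k Kk kw] := toroot0 w; have [_ KM _] := KS.
  exists (theta (tt ^- n) * k); first by apply: KM => //; exists (tt ^- n).
  by rewrite /= thtXVE; have := chart_shift o i n 0 w; rewrite addn0 => ->.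
have [m] := ubnP (size v); elim: m v => // m IHm [|x v] vm.
  by exists 1; [case: KS|rewrite root_chart].
(* An element of [G] turns the first letter into [i], and [tt] then deletes it, as
   [chart 1 (i :: u) = chart 0 u]. *)
have [g Gg gx] : exists2 g, (G : set _) g & g [:: x] = [:: i].
  by apply: trG; [exists x|exists i].
have [|k Kk kv] := IHm (sect g [:: x] v); first by rewrite aut_word_size.
exists (thG (subG Gg) * theta tt * k).
  have [_ KM _] := KS; apply: (KM) => //; apply: KM; last by exists tt.
  by exists (hnn_base sigma (subG Gg)).
by rewrite /= thG0 thtE /= -cat1s sectE gx /= chartS kv.
Qed.

Lemma closure_theta_scale_group : level1_transitive G ->
  scale_group [set val w | w in W].
Proof.
move=> trG; have [W1 WM WV] := WS; split.
- split; first by exists 1.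
    by move=> _ _ [x Wx <-] [y Wy <-]; exists (x * y) => //; exact: WM.
  by move=> _ [x Wx <-]; exists x^-1 => //; exact: WV.
- move=> g /aut_closureP clg.
  (* The limit is taken among all automorphisms; it still sends children to children, a condition on
     two vertices at a time, and so fixes [omega]. *)
  have go : fix_end (@omega d o) g.
    apply: fix_omega_child => p x.
    have [_ [k _ <-] kg] := clg [:: p; below p [:: x]].
    by rewrite -!kg ?inE ?eqxx ?orbT //; exact: aut_omega_below.
  exists (SigSub (mem_set go : g \in (aut_omega o : set _))) => //.
  apply/sub_closureP => s; have [_ [k Wk <-] kg] := clg s.
  have [l Kl lk] := (sub_closureP _ _).1 Wk s.
  by exists l => // v vs; rewrite lk // kg.
- move=> p q _ _.
  have [_ [k Kk <-] kp] := theta_transitive trG (I : setT p) (I : setT q).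
  by exists (val k) => //; exists k => //; exact: subset_closure.
- exists (@omega d o); first exact: omega_is_end.
  by move=> _ [k _ <-]; exact: set_mem (valP k).
Qed.

Let near_G (x : Gbar) s : exists g, {in s, forall w, val g w = val x w}.
Proof.
have [g Gg gs] := (aut_closureP _ _).1 (set_mem (valP x)) s.
by exists (subG Gg).
Qed.

(** The values of the [thG g] at a given vertex lie in a finite set, so that they
    converge along an ultrafilter on [G] converging to [x], whether or not
    [sigma] is continuous. *)
Lemma theta_limit (x : Gbar) : exists k : aut_omega o, forall s r, exists g,
  {in s, forall w, val g w = val x w} /\ {in r, forall p, val (thG g) p = val k p}.
Proof.
pose B s := [set g : G | {in s, forall w, val g w = val x w}].
have FF : ProperFilter (filter_from setT B).
  apply: filter_from_proper; last by move=> s _; have [g gs] := near_G x s; exists g.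
  apply: filter_from_filter; first by exists [::].
  move=> s1 s2 _ _; exists (s1 ++ s2) => // g gs.
  by split=> v vs; apply: gs; rewrite mem_cat vs ?orbT.
have [U [UU BU]] := ultraFilterLemma FF.
have limit (c : G -> G) p : exists q, U [set g | val (thG (c g)) p = q].
  have [n [w ->]] := chart_surj i p.
  (* Automorphisms preserve length, so the values come from the finitely many words of length
     [size w]. *)
  apply: (@ultra_finite_range _ _ U _
    [seq chart n (val u) | u <- enum {: (size w).-tuple 'I_d}]) => g.
  rewrite thGE; have sz : size (val (iter n sigma (c g)) w) == size w.
    by rewrite aut_word_size.
  by apply/mapP; exists (Tuple sz) => //; rewrite mem_enum.
(* Limits of the inverses along the same ultrafilter provide the inverse of [f]. *)
have /choice[f fE] := limit id; have /choice[f' f'E] := limit (fun g => g^-1).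
have fP : is_aut (Gr := rtree o) f.
  split=> //.
    exists f' => p.
      by have [g [/= <- <-]] := filter_ex (filterI (fE p) (f'E (f p))); exact: thGK.
    by have [g [/= <- <-]] := filter_ex (filterI (f'E p) (fE (f' p))); exact: thGVK.
  move=> p q; have [g [/= <- <-]] := filter_ex (filterI (fE p) (fE q)).
  exact: (aut_adj (Gr := rtree o)).
have fo : fix_end (@omega d o) (Aut fP).
  apply: fix_omega_child => p y /=.
  have [g [/= <- <-]] := filter_ex (filterI (fE p) (fE (below p [:: y]))).
  exact: aut_omega_below.
exists (SigSub (mem_set fo : Aut fP \in (aut_omega o : set _))) => s r.
have Us : U (B s) by apply: BU; exists s.
have Ur : U [set g | {in r, forall p, val (thG g) p = f p}].
  elim: r => [|p r IHr]; first exact: filterS filterT.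
  apply: filterS (filterI (fE p) IHr) => g [gp gs] q.
  by rewrite inE => /predU1P[->|/gs].
by have [g [gs gr]] := filter_ex (filterI Us Ur); exists g.
Qed.

Let near_base r (k : aut_omega o) : Prop :=
  exists g, {in r, forall p, val (thG g) p = val k p}.

Let near_base_W k : (forall r, near_base r k) -> W k.
Proof.
move=> nk; apply/sub_closureP => r; have [g gs] := nk r.
by exists (thG g) => //; exists (hnn_base sigma g).
Qed.

(** Each claim tests [k] and [x] on finitely many vertices at a time, so it passes to the limit. *)
Let limit_stab (k : aut_omega o) (x : Gbar) :
    (forall s r, exists g, {in s, forall w, val g w = val x w} /\
       {in r, forall p, val (thG g) p = val k p}) ->
  stab_root W k /\ pi_root k = val x.
Proof.
move=> kx; have kr : val k root = root.
  have [g [_ gr]] := kx [::] [:: root].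
  by rewrite -gr ?mem_head.
split; first split=> //.
  by apply: near_base_W => r; have [g [_ gs]] := kx [::] r; exists g.
apply: pi_root_eq => // w; have [g [gw gp]] := kx [:: w] [:: below root w].
by rewrite -gp ?mem_head // -!(chart0 o i) thG0 gw ?mem_head.
Qed.

Lemma pi_root_stab_closure : [set pi_root k | k in stab_root W] = Gbar.
Proof.
apply/seteqP; split=> [_ [k [Wk kr] <-]|x Gx].
  apply/aut_closureP => s.
  (* Agreement at the root makes [l] fix it; agreement at the vertices [below root w] makes the
     sections agree on [s]. *)
  have [l Kl lk] := (sub_closureP _ _).1 Wk (root :: map (below root) s).
  have lr : val l root = root by rewrite lk ?mem_head.
  exists (pi_root l); first by rewrite -pi_root_stab; exists l.
  move=> w ws; apply: (@below_inj _ o root); rewrite -!pi_rootE // lk //.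
  by rewrite inE map_f ?orbT.
have [k /limit_stab[kS kx]] := theta_limit (SigSub (mem_set Gx) : Gbar).
by exists k.
Qed.

(** * The extension of the action of [G] by continuity *)

Section Extension.
Variable theta_bar : Gbar -> aut_omega o.
Hypothesis theta_barP : extension_by_continuity (fun g => thG g) theta_bar.

(** By continuity, an element [g] of [G] close enough to [x] also has [thG g] close to
    [theta_bar x]. *)
Let near_bar (x : Gbar) s r : exists g,
  {in s, forall w, val g w = val x w} /\
  {in r, forall p, val (thG g) p = val (theta_bar x) p}.
Proof.
have [thC thE] := theta_barP.
have /thC/sub_nbhsP[s1 s1P] : nbhs (theta_bar x)
    [set k : aut_omega o | {in r, forall p, val k p = val (theta_bar x) p}].
  by apply/sub_nbhsP; exists r.
have [g gs] := near_G x (s ++ s1); exists g; split.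
  by move=> w ws; apply: gs; rewrite mem_cat ws.
have gb : val g \in (Gbar : set _).
  by apply: mem_set; apply: subset_closure; exact: set_mem (valP g).
move=> p ps; rewrite -(thE g (SigSub gb : Gbar)) //.
apply: s1P => // w ws; apply: gs.
by rewrite mem_cat ws orbT.
Qed.

(** Uniqueness of limits, one vertex at a time: by continuity the value of [thG g] at [p] is
    constant for [g] close to [x]. *)
Let bar_eq (x : Gbar) (k : aut_omega o) :
    (forall s p, exists g,
       {in s, forall w, val g w = val x w} /\ val (thG g) p = val k p) ->
  theta_bar x = k.
Proof.
have [thC thE] := theta_barP.
move=> kx; apply: val_inj; apply: aut_ext => p.
have /thC/sub_nbhsP[s sP] : nbhs (theta_bar x)
    [set k : aut_omega o | val k p = val (theta_bar x) p].
  by apply/sub_nbhsP; exists [:: p] => l lp; exact/lp/mem_head.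
have [g [gs <-]] := kx s p.
have gb : val g \in (Gbar : set _).
  by apply: mem_set; apply: subset_closure; exact: set_mem (valP g).
by rewrite -(thE g (SigSub gb : Gbar)) //; apply/esym/sP.
Qed.

(** The definition of [extension_by_continuity] does not mention products, so multiplicativity of
    [theta_bar] is first obtained by passing to the limit; [pi_root] is then its left inverse. *)
Lemma semidirect_stab_closure :
  semidirect (stab_root W) (ker_pi_root o `&` W) (range theta_bar).
Proof.
have [G1 GM GV] := closure_subgroup (subgroup_setP G).
have bar_pi x : stab_root W (theta_bar x) /\ pi_root (theta_bar x) = val x.
  by apply: limit_stab; exact: near_bar.
have bar1 (x : Gbar) : val x = 1 -> theta_bar x = 1.
  by move=> x1; apply: bar_eq => s p; exists 1; rewrite x1 thG1.
have barM (x y : Gbar) : exists2 z : Gbar, val z = val x * val y &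
    theta_bar z = theta_bar x * theta_bar y.
  have xy : val x * val y \in (Gbar : set _).
    by apply: mem_set; apply: GM; exact: set_mem (valP _).
  exists (SigSub xy : Gbar) => //; apply: bar_eq => s p.
  have [g [gs gp]] := near_bar x s [:: p].
  have [h [hs hp]] := near_bar y (map (val x) s) [:: val (theta_bar x) p].
  exists (g * h); split=> [w ws|]; first by rewrite /= gs // hs ?map_f.
  by rewrite thGM /= gp ?hp ?mem_head.
apply: semidirect_pi_root => //.
- split.
  + by exists (SigSub (mem_set G1) : Gbar) => //; exact: bar1.
  + by move=> _ _ [x _ <-] [y _ <-]; have [z _ <-] := barM x y; exists z.
  + move=> _ [x _ <-].
    have xV : (val x)^-1 \in (Gbar : set _).
      by apply: mem_set; apply: GV; exact: set_mem (valP _).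
    exists (SigSub xV : Gbar) => //; apply/esym/mulg1_eq.
    by have [z zE <-] := barM x (SigSub xV : Gbar); apply: bar1; rewrite zE mulgV.
- by move=> _ [x _ <-]; case: (bar_pi x).
- by move=> _ [x _ <-]; case: (bar_pi x) => _ -> /bar1.
- move=> k kS; have Gk : pi_root k \in (Gbar : set _).
    by apply: mem_set; rewrite -pi_root_stab_closure; exists k.
  exists (theta_bar (SigSub Gk : Gbar)); first by exists (SigSub Gk : Gbar).
  by case: (bar_pi (SigSub Gk : Gbar)).
Qed.

End Extension.

(** Continuity of [sigma] makes the value of [thG g] at [p] depend on finitely many values of [g],
    uniformly in [g]; the limits from [theta_limit] then form a continuous extension. *)
Lemma extension_exists : continuous sigma ->
  exists theta_bar : Gbar -> aut_omega o,
    extension_by_continuity (fun g => thG g) theta_bar.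
Proof.
move=> sigmaC; have [fb fbP] := choice theta_limit.
have sigmaXC n : continuous (iter n sigma).
  elim: n => [|n IHn] g; first exact.
  exact: (continuous_comp (IHn g) (sigmaC _)).
have unif p : exists s, forall g h, {in s, forall w, val g w = val h w} ->
    val (thG g) p = val (thG h) p.
  have [n [w ->]] := chart_surj i p.
  have /sigmaXC/sub_nbhsP[s sP] : nbhs (iter n sigma 1) [set g : G | val g w = w].
    rewrite lifting1; apply/sub_nbhsP; exists [:: w] => g gw; exact/gw/mem_head.
  exists s => g h gh; rewrite !thGE; congr chart.
  (* Continuity at 1 becomes uniform when applied to [g * h^-1]. *)
  have : val (iter n sigma (g * h^-1)) w = w.
    apply: sP => v vs; rewrite /= gh //.
    by rewrite -[LHS]/(val (h * h^-1) v) mulgV.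
  rewrite liftingM /= => E; rewrite -[in RHS]E.
  rewrite -[RHS]/(val (iter n sigma h^-1 * iter n sigma h) _) -liftingM mulVg.
  by rewrite lifting1.
exists fb; split=> [x U /sub_nbhsP[s sU]|g x xg].
  apply/sub_nbhsP; elim: s U sU => [|p s IHs] U sU.
    by exists [::] => y _; exact: sU.
  have [s1 s1P] := IHs _ (fun l ls => ls).
  have [s2 s2P] := unif p; exists (s1 ++ s2) => y xy; apply: sU => q.
  rewrite inE => /predU1P[->|qs]; last first.
    by apply: s1P qs => w ws; apply: xy; rewrite mem_cat ws.
  have [g [gx gp]] := fbP x s2 [:: p]; have [h [hy hp]] := fbP y s2 [:: p].
  rewrite -gp -?hp ?mem_head //; apply: s2P => w ws.
  by rewrite gx // hy // xy // mem_cat ws orbT.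
apply: val_inj; apply: aut_ext => p; have [s sP] := unif p.
have [h [hx hp]] := fbP x s [:: p].
by rewrite -hp ?mem_head //; apply: sP => w ws; rewrite hx // xg.
Qed.

End Representation.

Theorem theorem2 (d : nat) (d_ge2 : 2 <= d) (o : 'I_d) (o_eq0 : o = 0 :> nat)
    (G : subgroup (aut (tree d))) (i : 'I_d) (sigma : {multiplicative G -> G})
    (G_self_similar : self_similar G) (sigma_lifting : is_lifting i sigma) :
  exists2 theta : {multiplicative hnn sigma -> aut_omega o}, injective theta &
    let theta_G (g : G) := theta (hnn_base sigma g) in
    let K := range theta in
    let W := closure K in
    let Gbar := closure (G : set (aut (tree d))) in
    [/\ level1_transitive G ->
          [/\ self_replicating G,
              transitive_on [set val k | k in K] [set: rtree o]
            & scale_group [set val w | w in W]],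
        [set pi_root k | k in stab_root K] = G /\
          semidirect (stab_root K) (ker_pi_root o `&` K) (range theta_G)
      & [/\ [set pi_root w | w in stab_root W] = Gbar,
            forall theta_bar : Gbar -> aut_omega o,
              extension_by_continuity theta_G theta_bar ->
              semidirect (stab_root W) (ker_pi_root o `&` W) (range theta_bar)
          & continuous sigma ->
              exists theta_bar : Gbar -> aut_omega o,
                extension_by_continuity theta_G theta_bar]].
Proof.
have [theta [thG tht]] := hnn_action sigma_lifting o.
exists theta; first exact: theta_inj thG tht.
split.
- move=> trG; split; first exact: lifting_self_replicating sigma_lifting trG.
    exact: theta_transitive thG tht trG.
  exact: closure_theta_scale_group thG tht trG.
- split; first exact: pi_root_stab thG tht.
  exact: semidirect_stab thG tht.
- split; first exact: pi_root_stab_closure thG tht.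
    by move=> theta_bar; exact: semidirect_stab_closure thG tht _.
  exact: extension_exists thG.
Qed.
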